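(* Let $G=(V,A)$ be a directed acyclic graph, $L\subseteq V$ a set of ranked vertices and $r:V\to\mathbb{Z}^+\cup\{\infty\}$ injective on $L$ with $r=\infty$ on $V\setminus L$. Let $u,v\in V$. If $\rho(u)>_{\mathrm{lex}}\rho(v)$, then there is no directed path from $v$ to $u$ in $G$.
   Context: For a vertex $v$, $P(v)$ is the set of vertices $u$ such that there is a directed path from $u$ to $v$, and $S(v)$ the set of vertices $u$ with a directed path from $v$ to $u$; $v\in P(v)\cap S(v)$. Let $D(u,v)=S(u)\cap P(v)$. Define $A_1(v)=P(v)\cap L$; for $i\ge1$, if $A_i(v)\ne\emptyset$, let $\ell_i(v)$ be the vertex of $A_i(v)$ of minimum rank and $A_{i+1}(v)=(D(\ell_i(v),v)\setminus\{\ell_i(v)\})\cap L$. Let $k(v)=0$ if $A_1(v)=\emptyset$ and otherwise the largest $i$ with $A_i(v)\ne\emptyset$. The label of $v$ is $\ell(v)=(\ell_1(v),\ldots,\ell_{k(v)}(v))$ and its rank sequence is $\rho(v)=(r(\ell_1(v)),\ldots,r(\ell_{k(v)}(v)),+\infty)$. Rank sequences are compared lexicographically ($>_{\mathrm{lex}}$), with $+\infty$ larger than every integer. Equivalently, $\rho(u)>_{\mathrm{lex}}\rho(v)$ holds iff either (1) for some $1\le i\le k(u)$, $r(\ell_i(u))>r(\ell_i(v))$ and $\ell_j(u)=\ell_j(v)$ for all $j<i$, or (2) $k(u)<k(v)$ and $\ell_j(u)=\ell_j(v)$ for all $j\le k(u)$. *)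

(* Defs.v *)
From mathcomp Require Import all_boot all_order all_algebra.
From mathcomp Require Import constructive_ereal.

Set Implicit Arguments.
Unset Strict Implicit.
Unset Printing Implicit Defensive.

Import Order.TTheory GRing.Theory Num.Theory.

Local Open Scope order_scope.

(* Every closed directed walk is empty; in particular there are no loops. *)
Definition acyclic (V : finType) (e : rel V) : Prop :=
  forall c : seq V, cycle e c -> c = [::].

Section RankSequences.

Variables (V : finType) (e : rel V) (L : {set V}) (r : V -> \bar int).

Definition preds (v : V) : {set V} := [set u | connect e u v].
Definition succs (v : V) : {set V} := [set u | connect e v u].
Definition between (u v : V) : {set V} := succs u :&: preds v.

(* A vertex of minimum value of r in X; x0 is a junk value, returned only when *)
(* X is empty (it need not belong to X).                                       *)
Definition min_rank (x0 : V) (X : {set V}) : V := [arg min_(w < x0 in X) r w].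

(* candidates v 0, candidates v 1, ... are the successive sets A_1(v), A_2(v), *)
(* ... of ranked ancestors of v, and leader v 0, leader v 1, ... their vertices *)
(* l_1(v), l_2(v), ... of minimum rank: indices are shifted down by one. After *)
(* an empty set the sequence, which should stop, is padded with empty sets.    *)
Fixpoint candidates (v : V) (i : nat) : {set V} :=
  if i is j.+1 then
    let X := candidates v j in
    if X == set0 then set0
    else (between (min_rank v X) v :\ min_rank v X) :&: L
  else preds v :&: L.

Definition leader (v : V) (i : nat) : V := min_rank v (candidates v i).

(* The bound on i loses nothing in an acyclic graph: see label_sizeP.          *)
Definition label_size (v : V) : nat :=
  (\max_(i < #|V| | candidates v i != set0) i.+1)%N.

Definition label (v : V) : seq V := mkseq (leader v) (label_size v).

Definition rank_seq (v : V) : seqlexi (\bar int) :=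
  rcons [seq r w | w <- label v] +oo%E.

Lemma min_rankP (x0 : V) (X : {set V}) : X != set0 ->
  min_rank x0 X \in X /\ forall w, w \in X -> r (min_rank x0 X) <= r w.
Proof.
case/set0Pn => x xX; rewrite /min_rank /Order.arg_min /extremum.
case: pickP => [y /andP[yX /forall_inP ymin] //|none] /=.
have [y yX ymin] := Order.TotalTheory.arg_minP r xX.
have /negP[] := negbT (none y); apply/andP; split=> //.
by apply/forall_inP => z zX; apply: ymin.
Qed.

Lemma acyclic_anti (x y : V) : acyclic e ->
  connect e x y -> connect e y x -> x = y.
Proof.
move=> dag /connectP[p ep ->{y}] /connectP[q eq xE].
have: cycle e (p ++ q) by rewrite (cycle_path x) last_cat -xE cat_path ep.
by move/dag; case: {ep eq xE} p.
Qed.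

Lemma candidates_proper (v : V) (i : nat) : acyclic e ->
  candidates v i != set0 -> candidates v i.+1 \proper candidates v i.
Proof.
move=> dag Xi0; have [mX _] := min_rankP v Xi0.
apply/properP; split; last first.
  by exists (min_rank v (candidates v i)); rewrite //= (negPf Xi0) !inE eqxx.
apply/subsetP => w; rewrite [candidates v i.+1]/= (negPf Xi0) !inE.
case/andP=> /and3P[wm mw wv] wL.
case: i Xi0 mX wm mw => [|j] Xi0 mX wm mw; first by rewrite !inE wv.
move: mX mw; set m := min_rank v _; rewrite [candidates v j.+1]/=.
case: eqP => [_|_]; first by rewrite inE.
set n := min_rank v (candidates v j); rewrite !inE.
case/andP=> /and3P[mn nm _] _ mw.
rewrite wL wv (connect_trans nm mw) !andbT.
by apply: contra mn => /eqP wn; apply/eqP/(acyclic_anti dag); rewrite -?wn // wn.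
Qed.

Lemma label_sizeP (v : V) (i : nat) : acyclic e ->
  (i < label_size v)%N = (candidates v i != set0).
Proof.
move=> dag.
have down j : candidates v j = set0 -> candidates v j.+1 = set0.
  by move=> /= ->; rewrite eqxx.
apply/idP/idP => [|Xi0].
  apply: contraTneq => Xi0; rewrite -leqNgt; apply/bigmax_leqP => j.
  apply: contraNT; rewrite -ltnNge ltnS => /subnK <-.
  by elim: (_ - _)%N => [|d IHd]; rewrite ?add0n ?Xi0 // addSn down //; apply/eqP.
have card_bound j : candidates v j != set0 -> (#|candidates v j| + j <= #|V|)%N.
  elim: j => [|j IHj] Xj0; first by rewrite addn0 max_card.
  have Xj: candidates v j != set0 by apply: contra_neq Xj0; apply: down.
  apply: leq_trans (IHj Xj); rewrite addnS -addSn leq_add2r.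
  exact/proper_card/candidates_proper.
have iV : (i < #|V|)%N.
  apply: leq_trans (card_bound i Xi0); rewrite -[i.+1]add1n leq_add2r.
  by rewrite card_gt0.
exact: (@leq_bigmax_cond _ _ (fun j : 'I_#|V| => j.+1) (Ordinal iV)).
Qed.

End RankSequences.

(* Main.v *)
Require Import Defs.
From mathcomp Require Import all_boot all_order all_algebra.
From mathcomp Require Import constructive_ereal.

(** If v reaches u, every A_i(v) is contained in A_i(u) as long as the labels
    agree before i: passing from v to u only enlarges the sets over which the
    minimum ranks are taken.  At the first disagreement, the rank for u is thus
    the smaller one, +oo standing for the minimum over the empty set. *)

Set Implicit Arguments.
Unset Strict Implicit.
Unset Printing Implicit Defensive.

Import Order.TTheory.

Section RankTails.

Variables (V : finType) (e : rel V) (L : {set V}) (r : V -> \bar int).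
Hypothesis e_acyclic : acyclic e.

(** Suffixes of [rank_seq], so that the lexicographic order can be peeled entry by entry. Truncated
    subtraction leaves just [+oo] once [i] reaches the end of the label. *)
Definition rank_tail (v : V) (i : nat) : seqlexi (\bar int) :=
  rcons [seq r (leader e L r v j) | j <- iota i (label_size e L r v - i)] +oo%E.

Lemma rank_tail0 (v : V) : rank_tail v 0 = rank_seq e L r v.
Proof. by rewrite /rank_tail /rank_seq /label /mkseq -map_comp subn0. Qed.

Lemma rank_tailE (v : V) (i : nat) :
  rank_tail v i = if candidates e L r v i == set0 then [:: +oo%E]
                  else r (leader e L r v i) :: rank_tail v i.+1.
Proof.
rewrite /rank_tail; have := label_sizeP L r v i e_acyclic.
case: eqP => _ /= => [/negbT|lt_i]; first by rewrite -leqNgt -subn_eq0 => /eqP->.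
by rewrite -(subnSK lt_i).
Qed.

Lemma candidates_ranked (v : V) (i : nat) : candidates e L r v i \subset L.
Proof.
case: i => [|i] /=; first exact: subsetIr.
by case: ifP => _; rewrite ?sub0set ?subsetIr.
Qed.

Hypothesis r_fin : forall w, w \in L -> (r w < +oo)%E.
Hypothesis r_inj : {in L &, injective r}.

Lemma rank_tail_le (u v : V) (i : nat) : connect e v u ->
  candidates e L r v i \subset candidates e L r u i ->
  (rank_tail u i <= rank_tail v i)%O.
Proof.
(* Induction on the number of entries left in the label of [u], with [i] free to grow. *)
move=> vu; have [n] := ubnP (label_size e L r u - i).
elim: n i => // n IHn i size_lt sub_vu.
rewrite (rank_tailE u) (rank_tailE v).
have [Xu0|Xu_neq0] := eqVneq (candidates e L r u i) set0.
  by move: sub_vu; rewrite Xu0 subset0 => ->.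
have [lu_in lu_min] := min_rankP r u Xu_neq0.
have lu_L := subsetP (candidates_ranked u i) _ lu_in.
have [_|Xv_neq0] := eqVneq (candidates e L r v i) set0.
  (* Finiteness makes the first entries differ strictly. With a tie at [+oo], the longer sequence of
     [u] would be the larger one. *)
  have lu_fin := r_fin lu_L.
  by rewrite lexi_cons (ltW lu_fin) leNgt lu_fin.
have [lv_in _] := min_rankP r v Xv_neq0.
have lv_L := subsetP (candidates_ranked v i) _ lv_in.
have le_uv := lu_min _ (subsetP sub_vu _ lv_in).
rewrite lexi_cons le_uv; apply/implyP => le_vu.
(* Tied ranks force a common leader, since both leaders lie in [L]. *)
have leaderE : leader e L r u i = leader e L r v i.
  by apply: r_inj => //; apply/le_anti; rewrite le_uv.
apply: IHn.
  have lt_i : (i < label_size e L r u)%N by rewrite label_sizeP.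
  by rewrite -ltnS (leq_trans _ size_lt) // ltnS subnSK.
rewrite /= (negPf Xu_neq0) (negPf Xv_neq0) -!/(leader _ _ _ _ _) leaderE.
(* Both sets now start from the same leader, and a path ending at [v] extends to [u]. *)
apply/subsetP => w; rewrite !inE => /andP[/and3P[-> -> wv] ->].
by rewrite (connect_trans wv vu).
Qed.

End RankTails.

Theorem theorem1 (V : finType) (e : rel V) (L : {set V}) (r : V -> \bar int)
    (e_acyclic : acyclic e)
    (r_pos : forall w, (0 < r w)%E)
    (r_fin : forall w, w \in L -> (r w < +oo)%E)
    (r_infty : forall w, w \notin L -> r w = +oo%E)
    (r_inj : {in L &, injective r})
    (u v : V) :
  (rank_seq e L r u > rank_seq e L r v)%O -> ~ connect e v u.
Proof.
rewrite ltNge => /negP lt_vu vu; apply: lt_vu.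
rewrite -!rank_tail0; apply: rank_tail_le => //=.
(* Every ancestor of [v] is an ancestor of [u], which starts the induction at index 0. *)
by apply/setSI/subsetP => w; rewrite !inE => /connect_trans; apply.
Qed.
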